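(* Let $S$ be a subtractive valuation semiring and let $\mathfrak{a}$ be a nonzero proper ideal of $S$. Then the following statements are equivalent: (1) $\mathfrak{a}$ is a 2-absorbing ideal of $S$; (2) $\mathfrak{a}$ is a $\mathfrak{p}$-primary ideal of $S$ such that $\mathfrak{p}^2\subseteq\mathfrak{a}$, where $\mathfrak{p}=\sqrt{\mathfrak{a}}$ is a prime ideal of $S$; (3) $\mathfrak{a}=\mathfrak{p}$ or $\mathfrak{a}=\mathfrak{p}^2$, where $\mathfrak{p}=\sqrt{\mathfrak{a}}$ is a prime ideal of $S$.
   Context: A semiring is a set $S$ with operations $+,\cdot$ and elements $0\neq 1$ such that $(S,+,0)$ is a commutative monoid, $(S,\cdot,1)$ is a monoid, multiplication distributes over addition on both sides, and $a\cdot 0=0\cdot a=0$ for all $a\in S$. All semirings are assumed commutative (multiplication is commutative). An ideal of $S$ is a nonempty subset $\mathfrak{a}$ closed under addition with $sx\in\mathfrak{a}$ for all $s\in S$, $x\in\mathfrak{a}$; it is proper if $\mathfrak{a}\neq S$. The product of ideals is $IJ=\{\sum_{i=1}^n a_ib_i : a_i\in I,\ b_i\in J,\ n\in\mathbb{N}\}$, and $\mathfrak{p}^2=\mathfrak{p}\mathfrak{p}$. The radical is $\sqrt{\mathfrak{a}}=\{s\in S: s^n\in\mathfrak{a}\text{ for some } n\in\mathbb{N}\}$. An ideal $\mathfrak{a}$ is subtractive if $x+y\in\mathfrak{a}$ and $x\in\mathfrak{a}$ imply $y\in\mathfrak{a}$ for all $x,y\in S$; $S$ is subtractive if every ideal of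 $S$ is subtractive. A semidomain is a semiring in which $xy=xz$ and $x\neq 0$ imply $y=z$. A valuation semiring is a semidomain whose ideals are totally ordered by inclusion. A proper ideal $\mathfrak{p}$ is prime if $ab\in\mathfrak{p}$ implies $a\in\mathfrak{p}$ or $b\in\mathfrak{p}$. A proper ideal $\mathfrak{q}$ is primary if $xy\in\mathfrak{q}$ implies $x\in\mathfrak{q}$ or $y^n\in\mathfrak{q}$ for some $n\in\mathbb{N}$; it is $\mathfrak{p}$-primary if it is primary and $\sqrt{\mathfrak{q}}=\mathfrak{p}$. A proper ideal $\mathfrak{a}$ is 2-absorbing if, for $x,y,z\in S$, $xyz\in\mathfrak{a}$ implies $xy\in\mathfrak{a}$ or $yz\in\mathfrak{a}$ or $xz\in\mathfrak{a}$. *)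

(* Defs.v *)
From mathcomp Require Import all_boot all_algebra.
From mathcomp Require Import boolp classical_sets.

Set Implicit Arguments.
Unset Strict Implicit.
Unset Printing Implicit Defensive.

Import GRing.Theory.
Local Open Scope classical_set_scope.
Local Open Scope ring_scope.

Definition is_ideal (S : comNzSemiRingType) (I : set S) : Prop :=
  [/\ I !=set0,
      (forall x y, I x -> I y -> I (x + y))
    & (forall s x, I x -> I (s * x))].

Definition is_proper_ideal (S : comNzSemiRingType) (I : set S) : Prop :=
  is_ideal I /\ I <> setT.

Definition ideal_mul (S : comNzSemiRingType) (I J : set S) : set S :=
  [set x | exists (n : nat) (a b : 'I_n -> S),
     [/\ (forall i, I (a i)), (forall i, J (b i))
       & x = \sum_(i < n) a i * b i]].

(* Allowing the exponent 0 here and in [is_primary_ideal] is harmless: a proper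
   ideal does not contain 1, and an improper one contains every s ^+ 1. *)
Definition radical (S : comNzSemiRingType) (I : set S) : set S :=
  [set s | exists n : nat, I (s ^+ n)].

Definition is_subtractive_ideal (S : comNzSemiRingType) (I : set S) : Prop :=
  is_ideal I /\ forall x y, I (x + y) -> I x -> I y.

Definition subtractive_semiring (S : comNzSemiRingType) : Prop :=
  forall I : set S, is_ideal I -> is_subtractive_ideal I.

Definition semidomain (S : comNzSemiRingType) : Prop :=
  forall x y z : S, x * y = x * z -> x <> 0 -> y = z.

Definition valuation_semiring (S : comNzSemiRingType) : Prop :=
  semidomain S /\
  forall I J : set S, is_ideal I -> is_ideal J -> I `<=` J \/ J `<=` I.

Definition is_prime_ideal (S : comNzSemiRingType) (p : set S) : Prop :=
  is_proper_ideal p /\ forall a b, p (a * b) -> p a \/ p b.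

Definition is_primary_ideal (S : comNzSemiRingType) (q : set S) : Prop :=
  is_proper_ideal q /\
  forall x y, q (x * y) -> q x \/ exists n : nat, q (y ^+ n).

Definition primary_to (S : comNzSemiRingType) (p q : set S) : Prop :=
  is_primary_ideal q /\ radical q = p.

Definition two_absorbing (S : comNzSemiRingType) (I : set S) : Prop :=
  is_proper_ideal I /\
  forall x y z, I (x * y * z) -> [\/ I (x * y), I (y * z) | I (x * z)].

(* Main.v *)
Require Import Defs.
From mathcomp Require Import all_boot all_algebra.
From mathcomp Require Import boolp classical_sets.

(** Comparing principal ideals shows that divisibility is total in a valuation
    semiring. Hence the radical of any proper ideal is prime, and every element
    of a product [IJ] is a single product [xy] with [x] in [I] and [y] in [J].
    An element of a prime [p] is divisible by every [y] outside [p], with a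
    quotient in [p]; this makes a 2-absorbing ideal primary, and, by
    cancelling [y], it makes [p^2] primary. *)

Local Open Scope classical_set_scope.
Local Open Scope ring_scope.

Import GRing.Theory.

Lemma ideal0 {S : comNzSemiRingType} {I : set S} : is_ideal I -> I 0.
Proof. by case=> [[x Ix] _ IM]; rewrite -(mul0r x); apply: IM. Qed.

Lemma idealMl {S : comNzSemiRingType} {I : set S} (s : S) {x : S} :
  is_ideal I -> I x -> I (s * x).
Proof. by case=> _ _; apply. Qed.

Lemma idealMr {S : comNzSemiRingType} {I : set S} (s : S) {x : S} :
  is_ideal I -> I x -> I (x * s).
Proof. by rewrite mulrC; apply: idealMl. Qed.

Lemma proper_ideal_not1 {S : comNzSemiRingType} {I : set S} :
  is_proper_ideal I -> ~ I 1.
Proof.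
case=> Iid IT I1; apply: IT; rewrite -subTset => x _.
by rewrite -(mulr1 x); apply: idealMl.
Qed.

Lemma principal_ideal {S : comNzSemiRingType} (x : S) :
  is_ideal [set y | exists c, y = x * c].
Proof.
split; first by exists x, 1; rewrite mulr1.
- by move=> _ _ [c ->] [d ->]; exists (c + d); rewrite mulrDr.
- by move=> s _ [c ->]; exists (s * c); rewrite mulrCA.
Qed.

Lemma valuation_dvd_total {S : comNzSemiRingType} (x y : S) :
  valuation_semiring S -> (exists c, y = x * c) \/ (exists c, x = y * c).
Proof.
case=> _ /(_ _ _ (principal_ideal x) (principal_ideal y)) [] sub.
- by right; apply: sub; exists 1; rewrite mulr1.
- by left; apply: sub; exists 1; rewrite mulr1.
Qed.

Lemma sub_radical {S : comNzSemiRingType} {I : set S} : I `<=` radical I.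
Proof. by move=> x Ix; exists 1%N; rewrite expr1. Qed.

(** Since one of [x], [y] divides the other, [x + y] is a multiple of one of them, which gives
    closure under addition. *)
Lemma radical_prime {S : comNzSemiRingType} {I : set S} :
  valuation_semiring S -> is_proper_ideal I -> is_prime_ideal (radical I).
Proof.
move=> hval Iprop; have [Iid _] := Iprop.
have radM s x : radical I x -> radical I (s * x).
  by move=> [n In]; exists n; rewrite exprMn; apply: idealMl.
split; [split; first split|].
- by exists 0; apply: sub_radical; apply: ideal0.
- move=> x y radx rady.
  have [[c ->]|[c ->]] := valuation_dvd_total x y hval.
    by rewrite -{1}(mulr1 x) -mulrDr mulrC; apply: radM.
  by rewrite -{2}(mulr1 y) -mulrDr mulrC; apply: radM.
- exact: radM.
- move=> radT; have [n] : radical I 1 by rewrite radT.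
  by rewrite expr1n; apply: proper_ideal_not1.
- move=> x y [n In].
  have [[c yE]|[c xE]] := valuation_dvd_total x y hval.
    (* If [x] divides [y], then [x * y] divides [y * y], so [y ^+ (n + n)] is a multiple of
       [(x * y) ^+ n]. *)
    right; exists (n + n)%N.
    by rewrite exprD {1}yE -exprMn mulrAC exprMn; apply: idealMr.
  left; exists (n + n)%N.
  by rewrite exprD {2}xE -exprMn mulrA exprMn; apply: idealMr.
Qed.

Lemma prime_dvd {S : comNzSemiRingType} {p : set S} {x y : S} :
  valuation_semiring S -> is_prime_ideal p -> p x -> ~ p y ->
  exists2 c, p c & x = y * c.
Proof.
move=> hval [[pid _] pP] px py.
have [[c yE]|[c xE]] := valuation_dvd_total x y hval.
  by case: py; rewrite yE; apply: idealMr.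
by exists c => //; move: px; rewrite xE => /pP [].
Qed.

Lemma mem_ideal_mul {S : comNzSemiRingType} {I J : set S} {x y : S} :
  I x -> J y -> ideal_mul I J (x * y).
Proof. by exists 1%N, (fun=> x), (fun=> y); split=> //; rewrite big_ord1. Qed.

Lemma ideal_mul_sub {S : comNzSemiRingType} {I J K : set S} : is_ideal K ->
  (forall x y, I x -> J y -> K (x * y)) -> ideal_mul I J `<=` K.
Proof.
move=> Kid KM _ [n [u [v [Iu Jv ->]]]].
have [_ KD _] := Kid.
by apply: (big_ind K) => [||i _]; [exact: ideal0|exact: KD|exact: KM].
Qed.

(** The single products already form an ideal [K]; only closure under addition needs
    divisibility. *)
Lemma ideal_mul_single {S : comNzSemiRingType} {I J : set S} {x : S} :
  valuation_semiring S -> is_ideal I -> is_ideal J -> ideal_mul I J x ->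
  exists u v, [/\ I u, J v & x = u * v].
Proof.
move=> hval Iid Jid.
pose K := [set x | exists u v, [/\ I u, J v & x = u * v]].
apply: (@ideal_mul_sub _ I J K) => [|u v Iu Jv]; last by exists u, v.
split; first by exists 0, 0, 0; rewrite mul0r; split=> //; apply: ideal0.
- move=> _ _ [u [v [Iu Jv ->]]] [u' [v' [Iu' Jv' ->]]].
  (* [d] is whichever of [u], [u'] divides the other, hence in [I]; likewise [e] in [J] below. The
     sum is then a multiple of [d * e]. *)
  have [d [r [r' [Id uE uE']]]] : exists d r r', [/\ I d, u = d * r & u' = d * r'].
    have [[c E]|[c E]] := valuation_dvd_total u u' hval.
      by exists u, 1, c; rewrite mulr1.
    by exists u', c, 1; rewrite mulr1.
  have [e [t [t' [Je vE vE']]]] : exists e t t', [/\ J e, v = e * t & v' = e * t'].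
    have [[c E]|[c E]] := valuation_dvd_total v v' hval.
      by exists v, 1, c; rewrite mulr1.
    by exists v', c, 1; rewrite mulr1.
  exists (d * (r * t + r' * t')), e; split=> //; first exact: idealMr.
  by rewrite uE uE' vE vE' !(mulrACA d _ e) -mulrDr mulrAC.
- move=> s _ [u [v [Iu Jv ->]]].
  by exists (s * u), v; rewrite mulrA; split=> //; apply: idealMl.
Qed.

(** Descent on the exponent: splitting [x ^+ n.+2] as [x ^+ n * x * x] puts [x * x] or [x ^+ n.+1]
    in [I]. *)
Lemma two_absorbing_sqr {S : comNzSemiRingType} {I : set S} {x : S} :
  two_absorbing I -> radical I x -> I (x * x).
Proof.
move=> [[Iid _] I2] [n]; elim: n => [|[|n] IHn] Ixn.
- by rewrite -(mulr1 (x * x)); apply: idealMl.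
- by apply: idealMl.
- by move: Ixn; rewrite !exprSr => /I2 [||] //; rewrite -exprSr.
Qed.

Lemma two_absorbing_primary {S : comNzSemiRingType} {I : set S} :
  valuation_semiring S -> two_absorbing I -> is_primary_ideal I.
Proof.
move=> hval Iabs; have [Iprop I2] := Iabs.
have radP := radical_prime hval Iprop.
split=> // x y Ixy.
have [rady|rady] := pselect (radical I y); [by right | left].
have radx : radical I x by case: radP => _ /(_ x y (sub_radical _ Ixy)) [].
have [c _ xE] := prime_dvd hval radP radx rady.
(* The 2-absorbing property, applied to [y * y * c], leaves [y * c], which is [x], or [y * y],
   excluded as [y] is outside the radical. *)
move: Ixy; rewrite xE mulrAC => /I2 [Iyy| |] //.
by case: rady; exists 2%N; rewrite expr2.
Qed.

Lemma two_absorbing_radical_sqr {S : comNzSemiRingType} {I : set S} :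
  valuation_semiring S -> two_absorbing I ->
  ideal_mul (radical I) (radical I) `<=` I.
Proof.
move=> hval Iabs; have [[Iid _] _] := Iabs.
apply: ideal_mul_sub => // x y radx rady.
have [[c ->]|[c ->]] := valuation_dvd_total x y hval.
- by rewrite mulrA; apply: idealMr => //; apply: two_absorbing_sqr.
- by rewrite mulrAC; apply: idealMr => //; apply: two_absorbing_sqr.
Qed.

(** If neither [x * y] nor [y * z] lies in [I], primariness puts both [z] and [x] in the radical. *)
Lemma primary_two_absorbing {S : comNzSemiRingType} {I : set S} :
  is_primary_ideal I -> ideal_mul (radical I) (radical I) `<=` I ->
  two_absorbing I.
Proof.
move=> [Iprop IP] sqrI; split=> // x y z Ixyz.
have [Ixy|radz] := IP _ _ Ixyz; first by constructor 1.
have Iyzx : I (y * z * x) by rewrite mulrC mulrA.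
have [Iyz|radx] := IP _ _ Iyzx; first by constructor 2.
by constructor 3; apply: sqrI; apply: mem_ideal_mul.
Qed.

Lemma primary_between_sqr {S : comNzSemiRingType} {I : set S} :
  valuation_semiring S -> is_primary_ideal I ->
  ideal_mul (radical I) (radical I) `<=` I ->
  I = radical I \/ I = ideal_mul (radical I) (radical I).
Proof.
move=> hval [[Iid _] IP] sqrI.
have [Isqr|] := pselect (I `<=` ideal_mul (radical I) (radical I)).
  by right; apply/seteqP.
move=> /existsNP [z /not_implyP [Iz sqrz]].
left; apply/seteqP; split=> [|x radx]; first exact: sub_radical.
(* If [z = x * c], then [x] is in [I] or [c] is in the radical; the latter would put [z] in the
   square of the radical. *)
have [[c zE]|[c ->]] := valuation_dvd_total x z hval; last exact: idealMr.
move: Iz; rewrite zE => /IP [//|radc].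
by case: sqrz; rewrite zE; apply: mem_ideal_mul.
Qed.

Lemma prime_sqr_primary {S : comNzSemiRingType} {p : set S} {x y : S} :
  valuation_semiring S -> is_prime_ideal p ->
  ideal_mul p p (x * y) -> ~ p y -> ideal_mul p p x.
Proof.
move=> hval pP; have [[pid _] _] := pP.
move=> /(ideal_mul_single hval pid pid) [u [v [pu pv xyE]]] py.
have [c pc uE] := prime_dvd hval pP pu py.
have -> : x = c * v.
  (* Cancel [y] in [x * y = y * c * v]; [y] is nonzero because [0] lies in [p]. *)
  case: hval => sdom _; apply: (sdom y); first by rewrite mulrC xyE uE mulrA.
  by move=> y0; apply: py; rewrite y0; apply: ideal0.
exact: mem_ideal_mul.
Qed.

Theorem theorem3p13 (S : comNzSemiRingType)
    (hsub : subtractive_semiring S) (hval : valuation_semiring S)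
    (a : set S) (ha : is_proper_ideal a) (ha0 : a <> [set 0]) :
  let p := radical a in
  let stmt1 := two_absorbing a in
  let stmt2 := [/\ is_prime_ideal p, primary_to p a & ideal_mul p p `<=` a] in
  let stmt3 := is_prime_ideal p /\ (a = p \/ a = ideal_mul p p) in
  (stmt1 <-> stmt2) /\ (stmt2 <-> stmt3).
Proof.
move=> p stmt1 stmt2 stmt3.
have pP : is_prime_ideal p by apply: radical_prime.
split; split.
- move=> aabs; split=> //; last exact: two_absorbing_radical_sqr.
  by split=> //; apply: two_absorbing_primary.
- by move=> [_ [aP _] sqra]; apply: primary_two_absorbing.
- by move=> [_ [aP _] sqra]; split=> //; apply: primary_between_sqr.
- move=> [_ aE]; split=> //.
    split=> //; split=> // x y axy.
    (* As [p] is the radical of [a], [y] in [p] means that a power of [y] lies in [a]. *)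
    have [py|py] := pselect (p y); [by right | left].
    case: aE => aE; rewrite aE in axy *; first by case: pP => _ /(_ _ _ axy) [].
    exact: prime_sqr_primary axy py.
  have [[pid _] _] := pP.
  case: aE => ->; last by [].
  by apply: ideal_mul_sub => // x y _ py; apply: idealMl.
Qed.
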